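(* Let $\gamma>1$, let $\rho_-,\rho_+>0$ and $v_->v_+$ be real constants, and consider, for each $\kappa>0$, the Riemann problem for the isentropic Euler equations with pressure $p(\rho)=\kappa\rho^\gamma$ and left and right data $(\rho_-,v_-)$, $(\rho_+,v_+)$. Suppose that for some $\kappa_0>0$ the Riemann solution consists of a $1$-shock wave and a $2$-rarefaction wave (which forces $\rho_+>\rho_-$). For each $\kappa>0$ let $(\rho_*^\kappa,v_*^\kappa)$ denote the intermediate state of the Riemann solution with coefficient $\kappa$. Set $$\kappa_{sr}:=\frac{\rho_-\rho_+(v_--v_+)^2}{(\rho_+^{\gamma}-\rho_-^{\gamma})(\rho_+-\rho_-)}.$$ Then $$v_->v_*^{\kappa}>v_+\quad\text{for all }\kappa\in(0,\kappa_{sr}),$$ and, for $\kappa>0$, $$v_*^{\kappa}=v_+\iff \kappa=\kappa_{sr}.$$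
   Context: The isentropic Euler equations are $\partial_t\rho+\partial_x(\rho v)=0$, $\partial_t(\rho v)+\partial_x(\rho v^2+p)=0$, with $p=p(\rho)=\kappa\rho^\gamma$, $\kappa>0$, $\gamma>1$. The Riemann problem has initial data $(\rho,v)(x,0)=(\rho_\pm,v_\pm)$ for $\pm x>0$, with $\rho_\pm>0$. When $v_+-v_-<\frac{2\sqrt{\kappa\gamma}}{\gamma-1}\big(\rho_-^{\frac{\gamma-1}{2}}+\rho_+^{\frac{\gamma-1}{2}}\big)$ (automatic if $v_->v_+$), its solution (the self-similar entropy solution) consists of a $1$-wave joining $(\rho_-,v_-)$ to a constant intermediate state $(\rho_*^\kappa,v_*^\kappa)$ with $\rho_*^\kappa>0$, followed by a $2$-wave joining $(\rho_*^\kappa,v_*^\kappa)$ to $(\rho_+,v_+)$. The intermediate state is the unique pair satisfying one of the $1$-wave relations and one of the $2$-wave relations below (a wave is trivial, i.e. absent, when the two states it joins coincide): $1$-rarefaction: $v_*^\kappa=v_-+\frac{2\sqrt{\kappa\gamma}}{\gamma-1}\big(\rho_-^{\frac{\gamma-1}{2}}-(\rho_*^\kappa)^{\frac{\gamma-1}{2}}\big)$, $\rho_*^\kappa<\rho_-$. $1$-shock: $v_*^\kappa=v_--\sqrt{\frac{\kappa((\rho_*^\kappa)^\gamma-\rho_-^\gamma)}{\rho_*^\kappa\rho_-(\rho_*^\kappa-\rho_-)}}\,(\rho_*^\kappa-\rho_-)$, $\rho_*^\kappa>\rho_-$. $2$-rarefaction: $v_*^\kappa=v_+-\frac{2\sqrt{\kappa\gamma}}{\gamma-1}\big(\rho_+^{\frac{\gamma-1}{2}}-(\rho_*^\kappa)^{\frac{\gamma-1}{2}}\big)$,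 $\rho_*^\kappa<\rho_+$. $2$-shock: $v_*^\kappa=v_++\sqrt{\frac{\kappa(\rho_+^\gamma-(\rho_*^\kappa)^\gamma)}{\rho_+\rho_*^\kappa(\rho_+-\rho_*^\kappa)}}\,(\rho_*^\kappa-\rho_+)$, $\rho_*^\kappa>\rho_+$. Trivial $1$-wave: $(\rho_*^\kappa,v_*^\kappa)=(\rho_-,v_-)$; trivial $2$-wave: $(\rho_*^\kappa,v_*^\kappa)=(\rho_+,v_+)$. *)

(* Defs.v *)
From mathcomp Require Import all_boot all_order all_algebra.
From mathcomp Require Import all_classical all_reals all_analysis.

Set Implicit Arguments.
Unset Strict Implicit.
Unset Printing Implicit Defensive.

Import Order.TTheory GRing.Theory Num.Theory.
Local Open Scope ring_scope.

(** Wave relations for the isentropic Euler equations with pressure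
    p(rho) = kappa * rho ^ gamma.  In the 1-wave relations (rm, vm) is the left
    Riemann datum, in the 2-wave relations (rp, vp) is the right one; (r, v) is
    always the intermediate state. *)

Definition one_rarefaction (R : realType) (gamma kappa rm vm r v : R) : Prop :=
  v = vm + 2 * Num.sqrt (kappa * gamma) / (gamma - 1)
           * (rm `^ ((gamma - 1) / 2) - r `^ ((gamma - 1) / 2))
  /\ r < rm.

Definition one_shock (R : realType) (gamma kappa rm vm r v : R) : Prop :=
  v = vm - Num.sqrt (kappa * (r `^ gamma - rm `^ gamma) / (r * rm * (r - rm)))
           * (r - rm)
  /\ rm < r.

Definition two_rarefaction (R : realType) (gamma kappa rp vp r v : R) : Prop :=
  v = vp - 2 * Num.sqrt (kappa * gamma) / (gamma - 1)
           * (rp `^ ((gamma - 1) / 2) - r `^ ((gamma - 1) / 2))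
  /\ r < rp.

Definition two_shock (R : realType) (gamma kappa rp vp r v : R) : Prop :=
  v = vp + Num.sqrt (kappa * (rp `^ gamma - r `^ gamma) / (rp * r * (rp - r)))
           * (r - rp)
  /\ rp < r.

Definition trivial_wave (R : realType) (r0 v0 r v : R) : Prop :=
  r = r0 /\ v = v0.

Definition one_wave (R : realType) (gamma kappa rm vm r v : R) : Prop :=
  [\/ one_rarefaction gamma kappa rm vm r v,
      one_shock gamma kappa rm vm r v
    | trivial_wave rm vm r v].

Definition two_wave (R : realType) (gamma kappa rp vp r v : R) : Prop :=
  [\/ two_rarefaction gamma kappa rp vp r v,
      two_shock gamma kappa rp vp r v
    | trivial_wave rp vp r v].

Definition intermediate_state (R : realType)
    (gamma kappa rm vm rp vp r v : R) : Prop :=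
  [/\ 0 < r, one_wave gamma kappa rm vm r v & two_wave gamma kappa rp vp r v].

Definition kappa_sr (R : realType) (gamma rm vm rp vp : R) : R :=
  rm * rp * (vm - vp) ^+ 2 / ((rp `^ gamma - rm `^ gamma) * (rp - rm)).

(* Main.v *)
Require Import Defs.
From mathcomp Require Import all_boot all_order all_algebra.
From mathcomp Require Import all_classical all_reals all_analysis.
From mathcomp Require Import ring lra.

Set Implicit Arguments.
Unset Strict Implicit.
Unset Printing Implicit Defensive.

Import Order.TTheory GRing.Theory Num.Theory.
Local Open Scope ring_scope.

(** Along a shock the velocity jump squared is [kappa * H], where [H] is the
    Hugoniot function of the two densities; it does not involve [kappa] and
    increases with the density behind the shock.  A [1]-shock followed by a
    [2]-rarefaction, which occurs for [kappa0], compresses above [rm] and stays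
    below [rp], so [rm < rp].  As also [vp < vm], the [1]-wave is a shock for
    every [kappa]: otherwise [vm <= v], while the
    intermediate density would be below [rp], making the [2]-wave a
    rarefaction, across which [v < vp].  Hence
    [(vm - v) ^+ 2 = kappa * H rm r] for every intermediate state [(r, v)].

    The threshold is [kappa_sr = (vm - vp) ^+ 2 / H rm rp].  If the [2]-wave is
    a shock, then [vp < v] and [rp < r], so that
    [kappa * H rm rp < kappa * H rm r = (vm - v) ^+ 2 < (vm - vp) ^+ 2], that is
    [kappa < kappa_sr].  A rarefaction reverses every one of these
    inequalities, and a trivial [2]-wave turns them into equalities.  The sign
    of [v - vp] is therefore the sign of [kappa_sr - kappa]
    ([intermediate_trichotomy]), while [v < vm] holds across any [1]-shock. *)

Definition hugoniot (R : realType) (gamma r0 r : R) : R :=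
  (r `^ gamma - r0 `^ gamma) * (r0^-1 - r^-1).

Lemma powR_lt (R : realType) (a x y : R) :
  0 < a -> 0 < x -> x < y -> x `^ a < y `^ a.
Proof.
move=> a0 x0 xy; apply: gt0_ltr_powR => //; rewrite nnegrE ltW //.
exact: lt_trans xy.
Qed.

Lemma hugoniot_gt0 (R : realType) (gamma r0 r : R) :
  0 < gamma -> 0 < r0 -> r0 < r -> 0 < hugoniot gamma r0 r.
Proof.
move=> g0 r00 r0r; rewrite mulr_gt0 // subr_gt0; first exact: powR_lt.
by rewrite ltf_pV2 // posrE (lt_trans r00).
Qed.

(** Both factors are positive and increase with [r]. *)
Lemma hugoniot_lt (R : realType) (gamma r0 r r' : R) :
  0 < gamma -> 0 < r0 -> r0 < r -> r < r' ->
  hugoniot gamma r0 r < hugoniot gamma r0 r'.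
Proof.
move=> g0 r00 r0r rr'; have rp := lt_trans r00 r0r.
have rp' := lt_trans rp rr'.
apply: ltr_pM.
- by rewrite subr_ge0 ltW // powR_lt.
- by rewrite subr_ge0 ltW // ltf_pV2 // posrE.
- by rewrite ltrD2r powR_lt.
- by rewrite ltrD2l ltrN2 ltf_pV2 // posrE.
Qed.

(** Moving the positive factor [r - r0] inside the square root turns the
    shock relation of the Riemann problem into the Hugoniot form. *)
Lemma shock_jumpE (R : realType) (gamma kappa r0 r : R) :
  0 < r0 -> r0 < r ->
  Num.sqrt (kappa * (r `^ gamma - r0 `^ gamma) / (r * r0 * (r - r0)))
    * (r - r0) = Num.sqrt (kappa * hugoniot gamma r0 r).
Proof.
move=> r00 r0r; have rp := lt_trans r00 r0r.
have d0 : 0 < r - r0 by rewrite subr_gt0.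
rewrite -{2}(gtr0_norm d0) -sqrtr_sqr mulrC -sqrtrM ?sqr_ge0 //.
congr Num.sqrt; rewrite /hugoniot; field.
by rewrite (gt_eqF d0) !gt_eqF.
Qed.

Lemma one_rarefaction_gt (R : realType) (gamma kappa rm vm r v : R) :
  1 < gamma -> 0 < kappa -> 0 < r ->
  one_rarefaction gamma kappa rm vm r v -> vm < v.
Proof.
move=> g1 k0 r0 [-> rrm]; rewrite ltrDl.
have g0 : 0 < gamma by apply: lt_trans g1.
rewrite mulr_gt0 ?divr_gt0 ?mulr_gt0 ?sqrtr_gt0 ?mulr_gt0 ?subr_gt0 //.
by rewrite powR_lt // divr_gt0 // subr_gt0.
Qed.

Lemma two_rarefaction_lt (R : realType) (gamma kappa rp vp r v : R) :
  1 < gamma -> 0 < kappa -> 0 < r ->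
  two_rarefaction gamma kappa rp vp r v -> v < vp.
Proof.
move=> g1 k0 r0 [-> rrp]; rewrite ltrBlDr ltrDl.
have g0 : 0 < gamma by apply: lt_trans g1.
rewrite mulr_gt0 ?divr_gt0 ?mulr_gt0 ?sqrtr_gt0 ?mulr_gt0 ?subr_gt0 //.
by rewrite powR_lt // divr_gt0 // subr_gt0.
Qed.

Lemma one_shock_jump (R : realType) (gamma kappa rm vm r v : R) :
  0 < rm -> one_shock gamma kappa rm vm r v ->
  vm - v = Num.sqrt (kappa * hugoniot gamma rm r).
Proof. by move=> rm0 [-> rmr]; rewrite shock_jumpE // subKr. Qed.

Lemma two_shock_jump (R : realType) (gamma kappa rp vp r v : R) :
  0 < rp -> two_shock gamma kappa rp vp r v ->
  v - vp = Num.sqrt (kappa * hugoniot gamma rp r).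
Proof.
move=> rp0 [-> rpr]; rewrite -shock_jumpE // addrC addKr.
(* In the [2]-shock relation both differences carry the opposite sign, which
   cancels in their quotient. *)
congr (Num.sqrt _ * _).
have r0 : 0 < r by apply: lt_trans rpr.
have d1 : 0 < r - rp by rewrite subr_gt0.
have d2 : rp - r < 0 by rewrite subr_lt0.
by field; rewrite (gt_eqF d1) (lt_eqF d2) !gt_eqF.
Qed.

Lemma kappa_srE (R : realType) (gamma rm vm rp vp : R) :
  0 < gamma -> 0 < rm -> rm < rp ->
  kappa_sr gamma rm vm rp vp = (vm - vp) ^+ 2 / hugoniot gamma rm rp.
Proof.
move=> g0 rm0 rmp; have rp0 := lt_trans rm0 rmp.
have dp : 0 < rp `^ gamma - rm `^ gamma by rewrite subr_gt0 powR_lt.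
have dr : 0 < rp - rm by rewrite subr_gt0.
rewrite /kappa_sr /hugoniot; field.
by rewrite (gt_eqF dp) !gt_eqF // mulN1r.
Qed.

(** A [1]-wave without compression would leave the fluid at least as fast as
    [vm], yet at a density below [rp] the [2]-wave requires [v < vp]. *)
Lemma one_wave_is_shock (R : realType) (gamma kappa rm vm rp vp r v : R) :
  1 < gamma -> 0 < kappa -> 0 < rm -> rm < rp -> vp < vm ->
  intermediate_state gamma kappa rm vm rp vp r v ->
  one_shock gamma kappa rm vm r v.
Proof.
move=> g1 k0 rm0 rmp vpm [r0 W1 W2].
suff no_shock : r <= rm -> vm <= v -> False.
  case: W1 => [W|//|[er ev]].
  - by case: no_shock; [case: W => _ /ltW | exact/ltW/(one_rarefaction_gt _ _ _ W)].
  - by case: no_shock; rewrite ?er ?ev.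
move=> rrm vmv; have rrp := le_lt_trans rrm rmp.
case: W2 => [W|[_ rpr]|[er _]].
- have := two_rarefaction_lt g1 k0 r0 W; lra.
- lra.
- lra.
Qed.

Lemma intermediate_trichotomy (R : realType) (gamma kappa rm vm rp vp r v : R) :
  1 < gamma -> 0 < kappa -> 0 < rm -> rm < rp -> vp < vm ->
  intermediate_state gamma kappa rm vm rp vp r v ->
  [\/ [/\ vp < v, v < vm & kappa < kappa_sr gamma rm vm rp vp],
      v = vp /\ kappa = kappa_sr gamma rm vm rp vp
    | v < vp /\ kappa_sr gamma rm vm rp vp < kappa].
Proof.
move=> g1 k0 rm0 rmp vpm state; have g0 : 0 < gamma by apply: lt_trans g1.
have S1 := one_wave_is_shock g1 k0 rm0 rmp vpm state; case: (S1) => _ rmr.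
have Hr := hugoniot_gt0 g0 rm0 rmr; have Hp := hugoniot_gt0 g0 rm0 rmp.
have jump := one_shock_jump rm0 S1.
have vvm : v < vm by rewrite -subr_gt0 jump sqrtr_gt0 mulr_gt0.
have sq : kappa * hugoniot gamma rm r = (vm - v) ^+ 2.
  by rewrite jump sqr_sqrtr // ltW // mulr_gt0.
rewrite kappa_srE //; case: state => r0 _ [W2|W2|[er ev]].
- have vvp := two_rarefaction_lt g1 k0 r0 W2.
  apply: Or33; split=> //; rewrite ltr_pdivrMr //.
  apply: (@lt_trans _ _ (kappa * hugoniot gamma rm r)); last first.
    by rewrite ltr_pM2l // hugoniot_lt //; case: W2.
  by rewrite sq ltr_pXn2r ?nnegrE //; lra.
- have rp0 := lt_trans rm0 rmp; have rpr : rp < r by case: W2.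
  have vpv : vp < v.
    by rewrite -subr_gt0 (two_shock_jump rp0 W2) sqrtr_gt0 mulr_gt0 // hugoniot_gt0.
  apply: Or31; split=> //; rewrite ltr_pdivlMr //.
  apply: (@lt_trans _ _ (kappa * hugoniot gamma rm r)).
    by rewrite ltr_pM2l // hugoniot_lt.
  by rewrite sq ltr_pXn2r ?nnegrE //; lra.
- apply: Or32; split=> //; rewrite -ev -sq er mulfK //.
  by rewrite gt_eqF.
Qed.

Theorem lemma3p1 (R : realType) (gamma rm vm rp vp : R)
    (hgamma : 1 < gamma) (hrm : 0 < rm) (hrp : 0 < rp) (hv : vp < vm)
    (rs vs : R -> R)
    (hstate : forall kappa : R, 0 < kappa ->
       intermediate_state gamma kappa rm vm rp vp (rs kappa) (vs kappa))
    (hsr : exists kappa0 : R,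
       [/\ 0 < kappa0,
           one_shock gamma kappa0 rm vm (rs kappa0) (vs kappa0)
         & two_rarefaction gamma kappa0 rp vp (rs kappa0) (vs kappa0)]) :
  (forall kappa : R, 0 < kappa -> kappa < kappa_sr gamma rm vm rp vp ->
     vp < vs kappa /\ vs kappa < vm)
  /\
  (forall kappa : R, 0 < kappa ->
     (vs kappa = vp <-> kappa = kappa_sr gamma rm vm rp vp)).
Proof.
have rmp : rm < rp by case: hsr => k [_ [_ +] [_]]; exact: lt_trans.
have tri (k : R) (k0 : 0 < k) :=
  intermediate_trichotomy hgamma k0 hrm rmp hv (hstate k k0).
split=> [k k0 klt | k k0].
  by case: (tri k k0) => [[]//|[_ e]|[_ lt]]; lra.
by case: (tri k k0) => [[? ? ?]|[]//|[? ?]]; split=> ?; lra.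
Qed.
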